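(* Let $q\ge 4$ be an even prime power. If $0\le t\le q-1$ and $t\ne 1$, then \[ r\bigl(C_4,B_{(q-1)^2+(t-2)}\bigr)=q^2+t. \]
   Context: For graphs $H_1,H_2$, the Ramsey number $r(H_1,H_2)$ is the smallest integer $N$ such that for every graph $G$ on $N$ vertices, either $G$ contains $H_1$ as a subgraph or the complement $\overline{G}$ contains $H_2$ as a subgraph. $C_4$ denotes the cycle of length 4. For $n\ge 1$, the book $B_n$ is the graph consisting of $n$ triangles sharing a common edge. *)

(* Defs.v *)
From mathcomp Require Import all_boot.

Set Implicit Arguments.
Unset Strict Implicit.
Unset Printing Implicit Defensive.

Record sgraph := SGraph {
  svertex :> finType;
  sedge : rel svertex;
  sedge_sym : symmetric sedge;
  sedge_irrefl : irreflexive sedge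
}.

Definition compl_edge (G : sgraph) : rel G :=
  fun x y => (x != y) && ~~ sedge x y.

Lemma compl_edge_sym (G : sgraph) : symmetric (@compl_edge G).
Proof. by move=> x y; rewrite /compl_edge /= eq_sym sedge_sym. Qed.

Lemma compl_edge_irrefl (G : sgraph) : irreflexive (@compl_edge G).
Proof. by move=> x; rewrite /compl_edge /= eqxx. Qed.

Definition compl (G : sgraph) : sgraph :=
  SGraph (@compl_edge_sym G) (@compl_edge_irrefl G).

(* Subgraphs are not required to be induced. *)
Definition has_subgraph (G H : sgraph) : Prop :=
  exists f : H -> G,
    injective f /\ forall x y : H, sedge x y -> sedge (f x) (f y).

Definition ramsey_property (H1 H2 : sgraph) (N : nat) : Prop :=
  forall G : sgraph, #|G| = N -> has_subgraph G H1 \/ has_subgraph (compl G) H2.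

(* [is_ramsey_number H1 H2 N] reads r(H1, H2) = N; it includes the fact that
   the minimum exists. *)
Definition is_ramsey_number (H1 H2 : sgraph) (N : nat) : Prop :=
  ramsey_property H1 H2 N /\
  forall M : nat, ramsey_property H1 H2 M -> N <= M.

Definition C4_edge : rel 'I_4 :=
  fun i j => (j == i.+1 %% 4 :> nat) || (i == j.+1 %% 4 :> nat).

Lemma C4_edge_sym : symmetric C4_edge.
Proof. by move=> i j; rewrite /C4_edge /= orbC. Qed.

Lemma C4_edge_irrefl : irreflexive C4_edge.
Proof. by case=> [[|[|[|[|i]]]] Hi]. Qed.

Definition C4 : sgraph := SGraph C4_edge_sym C4_edge_irrefl.

(* The two [inl] vertices span the common edge; [inr i] is the apex of the
   i-th triangle. *)
Definition book_edge (n : nat) : rel (bool + 'I_n) :=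
  fun u v => match u, v with
  | inl a, inl b => a != b
  | inl _, inr _ => true
  | inr _, inl _ => true
  | inr _, inr _ => false
  end.

Lemma book_edge_sym (n : nat) : symmetric (@book_edge n).
Proof. by move=> [a|i] [b|j] //=; rewrite eq_sym. Qed.

Lemma book_edge_irrefl (n : nat) : irreflexive (@book_edge n).
Proof. by move=> [a|i] //=; rewrite eqxx. Qed.

Definition book (n : nat) : sgraph :=
  SGraph (@book_edge_sym n) (@book_edge_irrefl n).

Definition prime_power (q : nat) : Prop :=
  exists p k : nat, [/\ prime p, 0 < k & q = p ^ k].

(* Main.v *)
(* A graph G avoids a book B_n in its complement iff nonadjacent u, v always have
   fewer than n common non-neighbours; in a C4-free graph this reads
   d(u) + d(v) - codeg(u, v) >= |G| - 1 - n, with codeg <= 1.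

   Upper bound: with |G| = q^2 + t the right-hand side is 2q. Counting 2-paths
   from a vertex v gives sum_(w ~ v) (d(w) - 1) <= |G| - 1 <= q^2 + q - 2. If some
   degree is below q, all its non-neighbours have degree above q, and counting
   2-paths from one of them is a contradiction. So all degrees are at least q; two
   vertices of degree q with a common neighbour are adjacent, hence no vertex has
   three neighbours of degree q, while the 2-path count gives every vertex of
   degree above q at least two of them. Around a vertex of degree q this forces
   a C4.

   Lower bound: a C4-free graph on q^2 + t - 1 vertices with all degrees at least q
   suffices. It is cut out of the orthogonal polarity graph of PG(2,q), q even,
   whose absolute points lie on one line. *)
Require Import Defs.
From mathcomp Require Import all_boot.
From mathcomp Require Import all_algebra all_field.
From mathcomp Require Import zify ring.

Set Implicit Arguments.
Unset Strict Implicit.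
Unset Printing Implicit Defensive.
Import GRing.Theory.

(** * Degrees and codegrees in C4-free graphs, and books in the complement *)

Definition nbr (G : sgraph) (x : G) : {set G} := [set y | sedge x y].

Definition c4_free (G : sgraph) : Prop :=
  forall a c b d : G, a != c ->
    sedge a b -> sedge c b -> sedge a d -> sedge c d -> b = d.

Lemma in_nbr (G : sgraph) (x y : G) : (y \in nbr x) = sedge x y.
Proof. by rewrite inE. Qed.

Lemma c4_free_noC4 (G : sgraph) : c4_free G -> ~ has_subgraph G C4.
Proof.
move=> free [f [f_inj f_hom]].
pose o i (hi : i < 4) : C4 := Ordinal hi.
have ne : f (o 0 isT) != f (o 2 isT) by rewrite (inj_eq f_inj).
by have /f_inj/(congr1 val) := free _ _ (f (o 1 isT)) (f (o 3 isT)) ne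
  (f_hom (o 0 isT) (o 1 isT) isT) (f_hom (o 2 isT) (o 1 isT) isT)
  (f_hom (o 0 isT) (o 3 isT) isT) (f_hom (o 2 isT) (o 3 isT) isT).
Qed.

Lemma c4_free_or_C4 (G : sgraph) : c4_free G \/ has_subgraph G C4.
Proof.
case: (boolP [forall a : G, forall c : G,
               (a != c) ==> (#|nbr a :&: nbr c| <= 1)]) => [/forallP H | ].
  left=> a c b d ac ab cb ad cd; move/forallP/(_ c): (H a); rewrite ac /=.
  by move/card_le1_eqP; apply; rewrite !inE ?ab ?ad.
rewrite negb_forall => /existsP[a]; rewrite negb_forall => /existsP[c].
rewrite negb_imply -ltnNge => /andP[ac /card_gt1P[b [d []]]].
rewrite !inE => /andP[ab cb] /andP[ad cd] bd; right.
have ba : sedge b a by rewrite sedge_sym.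
have bc : sedge b c by rewrite sedge_sym.
have da : sedge d a by rewrite sedge_sym.
have dc : sedge d c by rewrite sedge_sym.
have ne x y : sedge x y -> x != y :> G.
  by apply: contraTneq => ->; rewrite sedge_irrefl.
have us : uniq [:: a; b; c; d].
  by rewrite /= !inE !negb_or ac bd !ne.
exists (fun i : 'I_4 => nth a [:: a; b; c; d] i); split.
  by move=> i j /eqP; rewrite nth_uniq //= => /eqP /val_inj.
by case=> [[|[|[|[|i]]]] hi] [[|[|[|[|j]]]] hj].
Qed.

Lemma codegree_le1 (G : sgraph) (x y : G) :
  c4_free G -> x != y -> #|nbr x :&: nbr y| <= 1.
Proof.
move=> free xy; apply/card_le1_eqP => b d.
rewrite !inE => /andP[xb yb] /andP[xd yd]; exact: (free _ _ _ _ xy).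
Qed.

(** The sum counts 2-paths from [v] to some [u != v]; such a [u] shares at most one neighbour with
    [v], so it is reached at most once. *)
Lemma sum_nbr_degrees (G : sgraph) (v : G) :
  c4_free G -> \sum_(w in nbr v) (#|nbr w|).-1 <= #|G|.-1.
Proof.
move=> free.
have -> : \sum_(w in nbr v) (#|nbr w|).-1 =
          \sum_(w in nbr v) \sum_(u | (u != v) && sedge w u) 1.
  apply: eq_bigr => w; rewrite in_nbr sedge_sym => wv.
  rewrite (cardsD1 v (nbr w)) in_nbr wv sum1_card /=.
  by apply: eq_card => u; rewrite !inE.
rewrite (exchange_big_dep (fun u => u != v)) /=; last by move=> w u _ /andP[].
have -> : #|G|.-1 = \sum_(u | u != v) 1.
  by rewrite sum1_card -(cardC1 v); apply: eq_card.
apply: leq_sum => u uv; rewrite sum1_card.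
apply: leq_trans (codegree_le1 _ uv) => //; apply: subset_leq_card.
apply/subsetP => w; rewrite unfold_in /= uv in_setI !in_nbr => /andP[vw wu].
by rewrite vw sedge_sym andbT; exact: wu.
Qed.

(** The vertices outside [W] are [u], [v] and their neighbours; nonadjacency makes {u, v} disjoint
    from both neighbourhoods. *)
Lemma card_pair_nbrs (G : sgraph) (u v : G) (W : {set G}) :
  u != v -> ~~ sedge u v ->
  (forall w, w \in W = compl_edge u w && compl_edge v w) ->
  #|W| + 2 + #|nbr u| + #|nbr v| = #|G| + #|nbr u :&: nbr v|.
Proof.
move=> uv nuv hW.
have nvu : ~~ sedge v u by rewrite sedge_sym.
rewrite -(cardsC W) -addnA -!addnA; congr (_ + _).
have -> : ~: W = [set u; v] :|: (nbr u :|: nbr v).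
  apply/setP => w; rewrite !inE hW /compl_edge !negb_and !negbK.
  by rewrite (eq_sym u) (eq_sym v); do !case: (_ == _) => //=; do !case: sedge.
have dis : [set u; v] :&: (nbr u :|: nbr v) = set0.
  apply/setP => w; rewrite !inE; case: eqVneq => [->|_] /=.
    by rewrite sedge_irrefl (negPf nvu).
  by case: eqVneq => [->|//]; rewrite sedge_irrefl (negPf nuv).
by rewrite cardsU dis cards0 subn0 cards2 uv -addnA cardsUI.
Qed.

Lemma book_in_compl (G : sgraph) (u v : G) (n : nat) :
  u != v -> ~~ sedge u v ->
  n + 2 + #|nbr u| + #|nbr v| <= #|G| + #|nbr u :&: nbr v| ->
  has_subgraph (compl G) (book n).
Proof.
move=> uv nuv.
pose W := [set w : G | compl_edge u w && compl_edge v w].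
rewrite -(@card_pair_nbrs _ _ _ W) //; last by move=> w; rewrite inE.
rewrite !leq_add2r => nW.
pose apex (i : 'I_n) : G := enum_val (widen_ord nW i).
have apexW i : compl_edge u (apex i) && compl_edge v (apex i).
  by have := enum_valP (widen_ord nW i); rewrite inE.
pose f (x : bool + 'I_n) : G :=
  match x with inl b => if b then u else v | inr i => apex i end.
have f_hom x y : book_edge x y -> compl_edge (f x) (f y).
  case: x y => [b|i] [c|j] //=; last 2 [by case: b; case/andP: (apexW j)];
    last by rewrite compl_edge_sym; case: c; case/andP: (apexW i).
  by case: b; case: c => // _; rewrite /compl_edge ?uv // eq_sym uv sedge_sym.
have ne x y : book_edge x y -> f x <> f y.
  by move=> /f_hom h e; move: h; rewrite e compl_edge_irrefl.
exists f; split=> // x y.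
case: x y => [b|i] [c|j] e.
- by case: (eqVneq b c) => [->//|bc]; case: (ne (inl b) (inl c)).
- by case: (ne (inl b) (inr j)).
- by case: (ne (inr i) (inl c)).
- by congr inr; move: e => /enum_val_inj /(congr1 val) /= /val_inj.
Qed.

(** * The upper bound *)

Lemma book_ramsey_upper (G : sgraph) (q t : nat) :
  4 <= q -> t < q -> #|G| = q ^ 2 + t -> c4_free G ->
  (forall u v : G, u != v -> ~~ sedge u v ->
     2 * q + #|nbr u :&: nbr v| <= #|nbr u| + #|nbr v|) -> False.
Proof.
move=> q4 tq cG free deg.
have sum_lt (v : G) : \sum_(w in nbr v) (#|nbr w|).-1 <= q * q + q - 2.
  apply: (leq_trans (sum_nbr_degrees v free)); rewrite cG; nia.
have degq (v : G) : q <= #|nbr v|.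
  (* Every non-neighbour of [v] has degree at least [r > q]. A non-neighbour [u] even has [r]
     neighbours outside [nbr v], so it starts at least r(r-1) >= q(q+1) 2-paths, too many for
     [sum_lt]. *)
  rewrite leqNgt; apply/negP => dv; set r := 2 * q - #|nbr v|.
  have : 0 < #|~: (v |: nbr v)|.
    have := cardsC (v |: nbr v); rewrite cardsU1 cG.
    by case: (_ \notin _) => /=; nia.
  case/card_gt0P => u; rewrite !inE negb_or => /andP[uv nvu].
  have nuv : ~~ sedge u v by rewrite sedge_sym.
  have hu := deg _ _ uv nuv.
  have far : r <= #|nbr u :\: nbr v|.
    by have := cardsID (nbr v) (nbr u); rewrite /r; lia.
  have : r * r.-1 <= \sum_(w in nbr u) (#|nbr w|).-1.
    rewrite (big_setID (nbr v)) /= -[r * _]add0n leq_add //.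
    apply: (@leq_trans (#|nbr u :\: nbr v| * r.-1)); first by rewrite leq_mul2r far orbT.
    rewrite -sum_nat_const; apply: leq_sum => w; rewrite !inE => /andP[nvw uw].
    have wv : w != v by apply: contraNneq nuv => <-.
    have := deg _ _ wv; rewrite sedge_sym => /(_ nvw); rewrite /r; lia.
  have := sum_lt u; have : q < r by rewrite /r; lia.
  by nia.
pose Q := [set x : G | #|nbr x| == q].
have Qadj x y v : x \in Q -> y \in Q -> x != y -> sedge v x -> sedge v y ->
    sedge x y.
  rewrite !inE => /eqP dx /eqP dy xy vx vy; apply: contraT => nxy.
  have := deg _ _ xy nxy; rewrite dx dy.
  have : 0 < #|nbr x :&: nbr y|.
    by apply/card_gt0P; exists v; rewrite !inE sedge_sym vx sedge_sym.
  by lia.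
have Qle2 (v : G) : #|nbr v :&: Q| <= 2.
  rewrite leqNgt; apply/negP => /card_gt2P[x [y [z [[]]]]].
  rewrite !(in_setI, in_nbr) => /andP[vx xQ] /andP[vy yQ] /andP[vz zQ].
  case=> xy yz zx.
  have xz : sedge x z by apply: (Qadj _ _ v); rewrite // eq_sym.
  have yz' : sedge y z by apply: (Qadj _ _ v).
  (* Both [z] and [v] are common neighbours of [x] and [y]. *)
  have zv : z = v by apply: (free _ _ _ _ xy); rewrite // sedge_sym.
  by rewrite zv sedge_irrefl in vz.
have Qge2 (v : G) : v \notin Q -> 2 <= #|nbr v :&: Q|.
  rewrite inE => dv.
  (* Each neighbour contributes at least q, except that those in [Q] contribute q-1. As [v] has at
     least q+1 neighbours, q(q+1) <= q^2 + q - 2 + #|nbr v :&: Q|. *)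
  have : \sum_(w in nbr v) q <=
         \sum_(w in nbr v) (#|nbr w|).-1 + \sum_(w in nbr v) (w \in Q).
    rewrite -big_split /=; apply: leq_sum => w _; rewrite inE.
    by have := degq w; case: eqVneq => /=; lia.
  rewrite sum_nat_const -big_mkcondr /= sum1_card.
  have -> : #|[pred w | w \in nbr v & w \in Q]| = #|nbr v :&: Q|.
    by apply: eq_card => w; rewrite !inE.
  by have := sum_lt v; have := degq v; nia.
have [v vQ] : exists v, v \in Q.
  have /card_gt0P[x _] : 0 < #|G| by rewrite cG; nia.
  case: (boolP (x \in Q)) => [xQ|/Qge2]; first by exists x.
  by case/ltnW/card_gt0P => y; rewrite in_setI => /andP[_ yQ]; exists y.
(* Here q >= 4 enters: at most two of the q or more neighbours lie in [Q]. *)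
have : 1 < #|nbr v :\: Q|.
  by have := cardsID Q (nbr v); have := Qle2 v; have := degq v; lia.
case/card_gt1P => w1 [w2 []]; rewrite !(in_setD, in_nbr).
move=> /andP[w1Q vw1] /andP[w2Q vw2] w12.
have third w : w \notin Q -> sedge v w ->
    exists2 x, x \in Q & [/\ x != v, sedge x w & sedge v x].
  move=> /Qge2 wQ vw; have : 0 < #|(nbr w :&: Q) :\ v|.
    by move: wQ; rewrite (cardsD1 v); lia.
  case/card_gt0P => x; rewrite !(in_setD1, in_setI, in_nbr) => /and3P[xv wx xQ].
  exists x => //; split=> //; first by rewrite sedge_sym.
  by apply: (Qadj _ _ w); rewrite // 1?eq_sym // sedge_sym.
have [x1 x1Q [x1v x1w vx1]] := third _ w1Q vw1.
have [x2 x2Q [x2v x2w vx2]] := third _ w2Q vw2.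
have x12 : x1 != x2.
  apply: contraNneq w12 => e; rewrite -e in x2w.
  by apply/eqP; apply: (free _ _ _ _ x1v).
(* The vertices [x1] and [v] have both [w1] and [x2] as common neighbours, but only [x2] lies in
   [Q]. *)
have e : w1 = x2 by apply: (free _ _ _ _ x1v) => //; apply: (Qadj _ _ v).
by rewrite e x2Q in w1Q.
Qed.

(** * Induced subgraphs and a criterion for the lower bound *)

Lemma induced_sym (G : sgraph) (A : {set G}) :
  symmetric (fun x y : {x | x \in A} => sedge (val x) (val y)).
Proof. by move=> x y; rewrite sedge_sym. Qed.

Lemma induced_irrefl (G : sgraph) (A : {set G}) :
  irreflexive (fun x y : {x | x \in A} => sedge (val x) (val y)).
Proof. by move=> x; rewrite sedge_irrefl. Qed.

Definition induced (G : sgraph) (A : {set G}) : sgraph :=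
  SGraph (@induced_sym G A) (@induced_irrefl G A).

(** For M <= #|A|, any M vertices of [A] induce a counterexample. The count takes place in all of
    [A], where the degree bound holds: the book and the neighbours of its spine would occupy at
    least (n + 2) + (2q - 1) vertices. *)
Lemma book_ramsey_lower (G : sgraph) (A : {set G}) (q n M : nat) :
  c4_free G -> (forall x, x \in A -> q <= #|nbr x :&: A|) ->
  #|A| <= n + 2 * q -> ramsey_property C4 (book n) M -> #|A| < M.
Proof.
move=> free degA cA ram; rewrite ltnNge; apply/negP => MA.
have [B BA cB] : exists2 B : {set G}, B \subset A & #|B| = M.
  exists [set x in take M (enum A)].
    by apply/subsetP => x; rewrite inE => /mem_take; rewrite mem_enum.
  rewrite cardsE (card_uniqP _) ?take_uniq ?enum_uniq //.
  by rewrite size_takel // -cardE.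
have [|[f [f_inj f_hom]]|[f [f_inj f_hom]]] := ram (induced B).
- by rewrite card_sig -cB; apply: eq_card.
- apply: (c4_free_noC4 free); exists (val \o f); split.
    exact: inj_comp val_inj f_inj.
  by move=> x y /f_hom.
pose u := val (f (inl true)); pose v := val (f (inl false)).
pose apex i := val (f (inr i)).
have fA x : val (f x) \in A by apply: (subsetP BA); exact: valP.
have := f_hom (inl true) (inl false) isT; rewrite /= => /andP[].
rewrite -val_eqE -/u -/v => uv nuv'; have nuv : ~~ sedge u v := nuv'.
pose W := [set apex i | i : 'I_n].
have cW : #|W| = n.
  by rewrite card_imset ?card_ord // => i j /val_inj /f_inj [].
pose Z := (u |: (v |: W)) :|: ((nbr u :&: A) :|: (nbr v :&: A)).
have ZA : Z \subset A.
  rewrite !subUset !sub1set !fA !subsetIr !andbT /=.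
  by apply/subsetP => _ /imsetP[i _ ->]; exact: fA.
have apex_u i : (u != apex i) && ~~ sedge u (apex i).
  by have := f_hom (inl true) (inr i) isT; rewrite /= /compl_edge -val_eqE.
have apex_v i : (v != apex i) && ~~ sedge v (apex i).
  by have := f_hom (inl false) (inr i) isT; rewrite /= /compl_edge -val_eqE.
have dis : (u |: (v |: W)) :&: ((nbr u :&: A) :|: (nbr v :&: A)) = set0.
  apply/setP => x; rewrite !in_setI !in_setU !in_setI !in_set1 !in_nbr in_set0.
  rewrite -andb_orl; apply/negP => /and3P[].
  case/or3P => [/eqP->|/eqP->|/imsetP[i _ ->]].
  - by rewrite sedge_irrefl (sedge_sym v) (negPf nuv).
  - by rewrite sedge_irrefl (negPf nuv).
  - by case/andP: (apex_u i) => _ /negPf->; case/andP: (apex_v i) => _ /negPf->.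
have cuvW : #|u |: (v |: W)| = n.+2.
  have vW : v \notin W.
    by apply/imsetP => -[i _ /eqP]; case/andP: (apex_v i) => /negPf->.
  have uW : u \notin W.
    by apply/imsetP => -[i _ /eqP]; case/andP: (apex_u i) => /negPf->.
  by rewrite !cardsU1 in_setU1 (negPf uv) (negPf uW) vW cW.
have cod : #|(nbr u :&: A) :&: (nbr v :&: A)| <= 1.
  apply: leq_trans (codegree_le1 free uv); apply: subset_leq_card.
  by apply: setISS; exact: subsetIl.
have := subset_leq_card ZA; rewrite /Z cardsU dis cards0 subn0 cuvW.
have := cardsUI (nbr u :&: A) (nbr v :&: A).
have := degA u (fA _); have := degA v (fA _); lia.
Qed.

(** * The polarity graph in characteristic 2 and its subgraphs of minimum degree q *)

Section PolarityGraph.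
Local Open Scope ring_scope.

(* Points of PG(2,F) other than (0:0:1): [inl (a, b)] is (1:a:b) and [inr d] is
   (0:1:d). Edges are the pairs orthogonal for x0*y0 + x1*y2 + x2*y1; in
   characteristic 2 the absolute points are those with x0 = 0. *)
Definition polarity_edge (F : finFieldType) : rel (F * F + F) :=
  fun x y => match x, y with
  | inl (a, b), inl (c, d) => a * d + c * b == 1
  | inl (a, b), inr d => b == d * a
  | inr d, inl (a, b) => b == d * a
  | inr _, inr _ => false
  end.

Lemma polarity_edge_sym (F : finFieldType) : symmetric (@polarity_edge F).
Proof. by move=> [[a b]|d] [[c e]|d'] //=; rewrite addrC. Qed.

Lemma polarity_edge_irrefl (F : finFieldType) :
  2%N \in [pchar F] -> irreflexive (@polarity_edge F).
Proof.
by move=> ch [[a b]|d] //=; rewrite (addrr_pchar2 ch) eq_sym oner_eq0.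
Qed.

Definition polarity_graph (F : finFieldType) (ch : 2%N \in [pchar F]) : sgraph :=
  SGraph (@polarity_edge_sym F) (polarity_edge_irrefl ch).

(** Neighbours of a point lie on its polar line, and the polars of two distinct points meet in a
    single point. *)
Lemma polarity_c4_free (F : finFieldType) (ch : 2%N \in [pchar F]) :
  c4_free (polarity_graph ch).
Proof.
have parallel (a1 a2 c1 c2 b1 b2 : F) :
    a1 * b2 + b1 * a2 = 1 -> c1 * b2 + b1 * c2 = 1 ->
    a1 * c2 - a2 * c1 = 0 -> (a1, a2) = (c1, c2).
  move=> e1 e2 D; congr pair.
    apply/eqP; rewrite -subr_eq0; apply/eqP.
    transitivity (b1 * (a1 * c2 - a2 * c1)); last by rewrite D mulr0.
    rewrite -{1}[a1]mulr1 -{1}[c1]mulr1 -{1}e2 -e1; ring.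
  apply/eqP; rewrite -subr_eq0; apply/eqP.
  transitivity (- b2 * (a1 * c2 - a2 * c1)); last by rewrite D mulr0.
  rewrite -{1}[a2]mulr1 -{1}[c2]mulr1 -{1}e2 -e1; ring.
have on_two_lines (a1 a2 b d : F) :
    b != d -> a2 = b * a1 -> a2 = d * a1 -> (a1, a2) = (0, 0).
  move=> bd e1 e2; have /eqP : (b - d) * a1 = 0 by rewrite mulrBl -e1 -e2 subrr.
  rewrite mulf_eq0 subr_eq0 (negPf bd) /= => /eqP a0.
  by rewrite e1 a0 mulr0.
move=> [[a1 a2]|a] [[c1 c2]|c] [[b1 b2]|b] [[d1 d2]|d] //= ne.
- move=> /eqP e1 /eqP e2 /eqP e3 /eqP e4.
  (* [b] and [d] solve the same linear system with this determinant; the identities below are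
     Cramer's rule. *)
  have D : a1 * c2 - a2 * c1 != 0.
    by apply: contraNneq ne => /(parallel _ _ _ _ _ _ e1 e2) ->.
  have z x y (e : (a1 * c2 - a2 * c1) * (x - y) = 0) : x = y.
    by move/eqP: e; rewrite mulf_eq0 (negPf D) subr_eq0 => /eqP.
  congr (inl (_, _)); apply: z.
    transitivity (a1 * ((c1 * b2 + b1 * c2) - (c1 * d2 + d1 * c2)) -
                  c1 * ((a1 * b2 + b1 * a2) - (a1 * d2 + d1 * a2))); first by ring.
    by rewrite e1 e2 e3 e4 !subrr !mulr0 subrr.
  transitivity (c2 * ((a1 * b2 + b1 * a2) - (a1 * d2 + d1 * a2)) -
                a2 * ((c1 * b2 + b1 * c2) - (c1 * d2 + d1 * c2))); first by ring.
  by rewrite e1 e2 e3 e4 !subrr !mulr0 subrr.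
- move=> /eqP e1 /eqP e2 /eqP e3 /eqP e4; case/eqP: ne.
  by rewrite (parallel _ _ _ _ _ _ e1 e2) // e3 e4; ring.
- move=> /eqP e3 /eqP e4 /eqP e1 /eqP e2; case/eqP: ne.
  by rewrite (parallel _ _ _ _ _ _ e1 e2) // e3 e4; ring.
- move=> /eqP e1 /eqP e2 /eqP e3 /eqP e4.
  case: (eqVneq b d) => [->//|bd]; case/eqP: ne.
  by rewrite (on_two_lines _ _ _ _ bd e1 e3) (on_two_lines _ _ _ _ bd e2 e4).
- move=> /eqP e1 /eqP e2 /eqP e3 /eqP e4.
  have h1 : b1 * (a1 * c + a2) = 1 by rewrite -e1 e2; ring.
  have h2 : d1 * (a1 * c + a2) = 1 by rewrite -e3 e4; ring.
  have b1d1 : b1 = d1 by rewrite -[b1]mulr1 -h2 mulrCA h1 mulr1.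
  by rewrite e2 e4 b1d1.
- move=> /eqP e1 /eqP e2 /eqP e3 /eqP e4.
  have h1 : b1 * (c1 * a + c2) = 1 by rewrite -e2 e1; ring.
  have h2 : d1 * (c1 * a + c2) = 1 by rewrite -e4 e3; ring.
  have b1d1 : b1 = d1 by rewrite -[b1]mulr1 -h2 mulrCA h1 mulr1.
  by rewrite e1 e3 b1d1.
- move=> /eqP e1 /eqP e2 /eqP e3 /eqP e4.
  have ac : a != c by apply: contraNneq ne => ->.
  by rewrite (on_two_lines _ _ _ _ ac e1 e2) (on_two_lines _ _ _ _ ac e3 e4).
Qed.

Lemma leq_card_nbrI (G : sgraph) (A : {set G}) (F : finType) (f : F -> G) x :
  injective f -> (forall s, sedge x (f s) && (f s \in A)) ->
  (#|F| <= #|nbr x :&: A|)%N.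
Proof.
move=> f_inj fA; rewrite -cardsT -(card_imset setT f_inj).
apply: subset_leq_card; apply/subsetP => _ /imsetP[s _ ->].
by rewrite in_setI in_nbr.
Qed.

(* Keep only the non-absolute points, without the pole (1:0:0) of the absolute line. *)
Definition affine_part (F : finFieldType) : {set F * F + F} :=
  [set x | if x is inl ab then ab != (0, 0) else false].

Lemma card_affine_part (F : finFieldType) :
  #|affine_part F| = (#|F| ^ 2).-1.
Proof.
have -> : affine_part F = inl @: [set~ (0, 0)].
  apply/setP => -[ab|d]; rewrite inE.
    by rewrite mem_imset ?inE // => x y [].
  by apply/esym/imsetP => -[].
rewrite card_imset => [|x y []//].
by rewrite cardsC1 card_prod mulnn.
Qed.

(** The affine neighbours of (a, b) form the line a y + b x = 1, which has #|F| points and misses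
    the origin. *)
Lemma affine_part_degree (F : finFieldType) (ch : 2%N \in [pchar F])
    (x : F * F + F) :
  x \in affine_part F -> (#|F| <= #|nbr (x : polarity_graph ch) :&: affine_part F|)%N.
Proof.
case: x => [[a b]|d]; rewrite in_set // => ab.
case: (eqVneq a 0) ab => [->|a0 _].
  case: (eqVneq b 0) => [->//|b0 _]; first by rewrite eqxx.
  apply: (@leq_card_nbrI (polarity_graph ch) _ _ (fun s : F => inl (b^-1, s))) => [s s' []//|s].
  by rewrite /= inE mul0r add0r mulVf // eqxx xpair_eqE invr_eq0 (negPf b0).
apply: (@leq_card_nbrI (polarity_graph ch) _ _ (fun s : F => inl (s, (1 - s * b) / a))).
  by move=> s s' [].
move=> s; rewrite /= inE mulrCA divff // mulr1 subrK eqxx /= xpair_eqE.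
case: eqVneq => //= ->; rewrite mul0r subr0 mul1r invr_eq0 //.
Qed.

(* Delete [T] from the line x1 = 0 tangent to the conic at the omitted point
   (0:0:1), sparing the pole (1:0:0). *)
Definition deleted_part (F : finFieldType) (T : {set F}) : {set F * F + F} :=
  ~: [set inl (0, c) | c in T].

Lemma card_deleted_part (F : finFieldType) (T : {set F}) :
  (#|deleted_part T| + #|T| = #|F| ^ 2 + #|F|)%N.
Proof.
rewrite -(@card_imset _ _ (fun c : F => inl (0, c) : F * F + F)); last first.
  by move=> c c' [].
by rewrite addnC cardsC card_sum card_prod mulnn.
Qed.

(** Only points with a != 0 can lose a neighbour, namely (0, 1/a), and these have degree #|F| + 1 in
    the whole graph. *)
Lemma deleted_part_degree (F : finFieldType) (ch : 2%N \in [pchar F])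
    (T : {set F}) (x : F * F + F) :
  0 \notin T -> x \in deleted_part T ->
  (#|F| <= #|nbr (x : polarity_graph ch) :&: deleted_part T|)%N.
Proof.
move=> T0 _.
have inr_in d : inr d \in deleted_part T.
  by rewrite inE; apply/imsetP => -[].
have inl_in a b : (a != 0) || (b == 0) -> inl (a, b) \in deleted_part T.
  rewrite inE => h; apply/imsetP => -[c cT [ea eb]]; move: h.
  by rewrite ea eqxx eb /=; apply/negP; apply: contraNneq T0 => <-.
case: x => [[a b]|d]; last first.
  apply: (@leq_card_nbrI (polarity_graph ch) _ _ (fun s : F => inl (s, d * s))) => [s s' []//|s].
  by rewrite /= eqxx inl_in //; case: eqVneq => //= ->; rewrite mulr0.
case: (eqVneq a 0) => [->|a0].
  case: (eqVneq b 0) => [->|b0].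
    apply: (@leq_card_nbrI (polarity_graph ch) _ _ (fun s : F => inr s)) => [s s' []//|s].
    by rewrite /= mulr0 eqxx inr_in.
  apply: (@leq_card_nbrI (polarity_graph ch) _ _ (fun s : F => inl (b^-1, s))) => [s s' []//|s].
  by rewrite /= mul0r add0r mulVf // eqxx inl_in // invr_eq0 b0.
(* At s = 0 the affine neighbour may be deleted, so the neighbour at infinity replaces it. *)
apply: (@leq_card_nbrI (polarity_graph ch) _ _ (fun s : F =>
  if s == 0 then inr (b / a) else inl (s, (1 - s * b) / a))).
  by move=> s s'; case: (eqVneq s 0) => [->|_]; case: (eqVneq s' 0) => [->|_] // [].
move=> s; case: eqVneq => [_|s0] /=; first by rewrite divfK // eqxx inr_in.
by rewrite mulrCA divff // mulr1 subrK eqxx inl_in // s0.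
Qed.

End PolarityGraph.

(** * The choice of the field and the Ramsey number *)

Lemma even_prime_power_field (q : nat) : prime_power q -> ~~ odd q ->
  exists2 F : finFieldType, 2 \in [pchar F]%R & #|F| = q.
Proof.
case=> p [k [p_pr k0 ->]]; rewrite oddX negb_or -lt0n k0 /= => p_even.
have p2 : p = 2 by case: (even_prime p_pr); rewrite // (negPf p_even).
by have [F ch cF] := PrimePowerField p_pr k0; exists F; rewrite -?p2.
Qed.

Theorem theorem2 (q t : nat) (hq : prime_power q) (hq_even : ~~ odd q)
    (hq4 : 4 <= q) (ht : t <= q - 1) (ht1 : t <> 1) :
  (* the subtractions in the book size never truncate, since 4 <= q *)
  is_ramsey_number C4 (book ((q - 1) ^ 2 + t - 2)) (q ^ 2 + t).
Proof.
set n := (q - 1) ^ 2 + t - 2.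
(* By this identity, a nonadjacent pair spans no book in the complement exactly when its degree sum
   is at least 2q plus its codegree. *)
have en : n + 2 * q + 1 = q ^ 2 + t.
  by rewrite /n; case: q hq4 {n ht hq hq_even} => // m hm; rewrite subn1 /=; nia.
split=> [G cG | M ram].
  pose small (u v : G) := [&& u != v, ~~ sedge u v &
    #|nbr u| + #|nbr v| < 2 * q + #|nbr u :&: nbr v|].
  case: (boolP [exists u, [exists v, small u v]]).
    case/existsP => u /existsP[v /and3P[uv nuv huv]]; right.
    by apply: (book_in_compl uv nuv); lia.
  move=> none; case: (c4_free_or_C4 G) => [free|]; last by left.
  exfalso; apply: (@book_ramsey_upper G q t) => //; first lia.
  move=> u v uv nuv; rewrite leqNgt; apply: contra none => huv.
  by apply/existsP; exists u; apply/existsP; exists v; apply/and3P.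
have [F ch cF] := even_prime_power_field hq hq_even.
have [t0|t0] := eqVneq t 0.
  have := @book_ramsey_lower (polarity_graph ch) (affine_part F) q n M
    (@polarity_c4_free F ch).
  rewrite card_affine_part cF => /(_ _ _ ram) h.
  have : (q ^ 2).-1 < M.
    by apply: h; [move=> x; rewrite -cF; exact: affine_part_degree | lia].
  lia.
(* Order q^2 + t - 1 means deleting q + 1 - t points with nonzero [c]; there are q - 1 of these,
   enough because t >= 2. *)
have [T T0 cT] : exists2 T : {set F}, 0%R \notin T & #|T| = q + 1 - t.
  have le : q + 1 - t <= #|[set~ 0%R : F]| by rewrite cardsC1 cF; lia.
  exists [set x in take (q + 1 - t) (enum [set~ 0%R : F])].
    by rewrite inE; apply/negP => /mem_take; rewrite mem_enum !inE eqxx.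
  rewrite cardsE (card_uniqP _) ?take_uniq ?enum_uniq //.
  by rewrite size_takel // -cardE.
have cA : #|deleted_part T| = n + 2 * q.
  by have := card_deleted_part T; rewrite cT cF; lia.
have := @book_ramsey_lower (polarity_graph ch) (deleted_part T) q n M
  (@polarity_c4_free F ch).
rewrite cA => /(_ _ _ ram) h.
have : n + 2 * q < M.
  by apply: h => // x; rewrite -cF; exact: deleted_part_degree.
lia.
Qed.
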